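(* If $\mathfrak{b}=\mathfrak{c}=\omega_2$, then there is a compact Hausdorff pseudoradial space that is not strongly pseudoradial.
   Context: $\mathfrak{c}=2^{\aleph_0}$ and $\mathfrak{b}$ is the bounding number (the least size of a family of functions $\omega\to\omega$ that is unbounded for eventual domination). Ordinals carry the order topology. A space $X$ is pseudoradial if for every non-closed $A\subset X$ there is a point $x\in\overline{A}\setminus A$ and a transfinite sequence $\langle x_\alpha\rangle_{\alpha<\kappa}$ with range in $A$ converging to $x$ (every neighborhood of $x$ contains $\{x_\alpha:\beta\le\alpha<\kappa\}$ for some $\beta<\kappa$). A space $X$ is strongly pseudoradial if for every non-closed $A\subset X$ there is a limit ordinal $\gamma$ and a continuous map $f:\gamma+1\to X$ such that $f[\gamma]\subset A$ and $f(\gamma)\notin A$. *)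

(* Defs.v *)
From HB Require Import structures.
From mathcomp Require Import all_boot all_order.
From mathcomp Require Import all_classical wochoice all_reals all_analysis.

Set Implicit Arguments.
Unset Strict Implicit.
Unset Printing Implicit Defensive.

Import Order.TTheory.

Local Open Scope classical_set_scope.
Local Open Scope order_scope.
Local Open Scope card_scope.

(* Ordinals are rendered as well-ordered types, each standing for its order    *)
(* type.  [well_order R] says that every nonempty subset has an R-minimum.     *)
HB.mixin Record Order_isWellOrder d (T : Type) & Order.Total d T := {
  le_well_order : well_order (@Order.le d T)
}.

#[short(type="ordinalType")]
HB.structure Definition Ordinal d :=
  { T of Order.Total d T & Order_isWellOrder d T }.

(* gamma + 1: the elements of gamma are the [Some a], and [None] is the point  *)
(* gamma on top.                                                               *)
Definition succ_ord (gamma : Type) : Type := option gamma.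

Section SuccOrd.
Context {d} {gamma : ordinalType d}.
Local Notation S := (succ_ord gamma).

Definition succ_ord_le : rel S := fun x y =>
  match x, y with
  | _, None => true
  | None, Some _ => false
  | Some a, Some b => a <= b
  end.

Lemma succ_ord_le_refl : reflexive succ_ord_le.
Proof. by case=> /=. Qed.

Lemma succ_ord_le_anti : antisymmetric succ_ord_le.
Proof. by case=> [a|] [b|] //= /le_anti ->. Qed.

Lemma succ_ord_le_trans : transitive succ_ord_le.
Proof. by case=> [a|] [b|] [c|] //=; exact: le_trans. Qed.

Lemma succ_ord_le_total : total succ_ord_le.
Proof. by case=> [a|] [b|] //=; exact: le_total. Qed.

HB.instance Definition _ := Choice.copy S (option gamma).
HB.instance Definition _ := Order.Le_isPOrder.Build d S
  succ_ord_le_refl succ_ord_le_anti succ_ord_le_trans.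
HB.instance Definition _ :=
  Order.POrder_isTotal.Build d S succ_ord_le_total.

Lemma succ_ord_well_order : well_order (@Order.le d S).
Proof.
apply: antisymmetric_well_order; first exact: le_anti.
move=> A [x Ax].
have [[a Aa]|noA] := pselect (exists a : gamma, (Some a : S) \in A).
  have [|m [[Am mlb] _]] := @le_well_order d gamma [pred a | (Some a : S) \in A].
    by exists a.
  exists (Some m : S); split=> // -[b|] Ab //; exact: mlb.
exists (None : S); split.
  by case: x Ax => // a Aa; case: noA; exists a.
by move=> [b|] Ab //; case: noA; exists b.
Qed.

HB.instance Definition _ := Order_isWellOrder.Build d S succ_ord_well_order.
End SuccOrd.

(* 0 is not counted as a limit ordinal. *)
Definition limit_ordinal d (gamma : ordinalType d) : Prop :=
  inhabited gamma /\ forall a : gamma, exists b : gamma, a < b.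

(* [is_omega n W]: W has order type omega_n.  omega_0 is the infinite ordinal  *)
(* all of whose predecessors are finite; omega_(n+1) is the least ordinal that *)
(* does not inject into omega_n.                                               *)
Fixpoint is_omega (n : nat) d (W : ordinalType d) : Prop :=
  match n with
  | 0%N => ~ finite_set [set: W] /\ forall a : W, finite_set [set b | b < a]
  | m.+1 => exists d' (V : ordinalType d'),
      [/\ is_omega m V, ~ ([set: W] #<= [set: V])
        & forall a : W, [set b | b < a] #<= [set: V]]
  end.

Definition eventually_dominated (f g : nat -> nat) : Prop :=
  \forall n \near \oo, (f n <= g n)%N.

Definition unbounded_family (F : set (nat -> nat)) : Prop :=
  ~ exists g, forall f, F f -> eventually_dominated f g.

(* |K| is the bounding number. *)
Definition is_bounding_number (K : Type) : Prop :=
  (exists2 F, unbounded_family F & F #= [set: K]) /\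
  (forall F, unbounded_family F -> [set: K] #<= F).

(* |K| is the cardinality of the continuum. *)
Definition is_continuum (K : Type) : Prop :=
  [set: nat -> bool] #= [set: K].

Definition transfinite_cvg d (kappa : ordinalType d) (X : topologicalType)
    (u : kappa -> X) (x : X) : Prop :=
  forall U, nbhs x U -> exists b, forall a, b <= a -> U (u a).

Definition pseudoradial (X : topologicalType) : Prop :=
  forall A : set X, ~ closed A ->
  exists2 x, (closure A `\` A) x &
  exists d (kappa : ordinalType d) (u : kappa -> X),
    (forall a, A (u a)) /\ transfinite_cvg u x.

Definition strongly_pseudoradial (X : topologicalType) : Prop :=
  forall A : set X, ~ closed A ->
  exists d (gamma : ordinalType d) (f : order_topology (succ_ord gamma) -> X),
    [/\ limit_ordinal gamma, continuous f,
        forall a : gamma, A (f (Some a)) & ~ A (f None)].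

(* Main.v *)
From HB Require Import structures.
Require Import Defs.
From mathcomp Require Import all_boot all_order finmap interval.
From mathcomp Require Import all_classical wochoice all_reals all_analysis.

(** The space is a compact, zero-dimensional space [X] with a continuous map onto
    [omega_1 + 1] whose fibre over [omega_1] is one point [top].  It is arranged
    that [top] is not reachable by any continuous transfinite sequence of other
    points, although every choice of one point in each level below [omega_1]
    converges to it.

    A continuous sequence that converges to [top] can be thinned so that its levels
    form an [omega^2]-sequence: for each [n] the levels [c n k] increase to [l n],
    and the [l n] increase to some countable ordinal [a].  Continuity forces the
    points at the levels [c n k] and [l n] to converge to one point of level [a].
    So it suffices to attach to each [a] a family [U a i], [i < omega_2], of clopen
    subsets of [a] such that (1) each such double sequence is split by some
    [U a i], while (2) each [omega]-sequence increasing to [a] has a subsequence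
    that no [U a i] splits.  Then [X] is the
    closure, in the power of the two-point space indexed by the pairs [(a, None)]
    and [(a, Some i)], of the points [trace x] that record which of the sets
    [[0, a]] and [U a i] contain [x].  Besides [trace a], its points of level [a] are
    limits of traces of ordinals increasing to [a], and they are told apart by the
    sets [U a i].

    The family is built by recursion on [i].  At stage [i] there are at most
    [omega_1] earlier sets and promised subsequences, and [c] is a double sequence
    that none of the earlier sets splits.  A new set is a union over [n] of
    intervals [(c n k, c n k.+1]] with [k = g n].  For each [n] all but finitely
    many of these intervals are inside or outside a given earlier set according to
    [l n], and miss a given earlier promised subsequence; since [b = omega_2], a
    single [g] can be chosen large enough for all the earlier sets at once.  The
    new set splits [c], and below [a] it is almost contained in or almost disjoint
    from each earlier set ([nested_below]).  This last property makes promises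
    possible: a nested family of fewer than [b] sets never splits all the
    subsequences of a sequence ([unsplit_subsequence]).  As the
    continuum is [omega_2], every double sequence and every simple sequence is
    treated at some stage.

    For pseudoradiality, let [x] be in the closure of [A] and not in [A].  If [x]
    is [top], an [omega_1]-sequence does.  If [x] has level [a] and near [x] the
    set [A] has no point of level [a], then (2) provides an [omega]-sequence.
    Otherwise, one takes points of [A] of level [a] that agree with [x] on longer
    and longer initial segments of the family [U a], as far as this is possible;
    nestedness implies that they converge to a point outside [A]
    ([radial_within]). *)

Set Implicit Arguments.
Unset Strict Implicit.
Unset Printing Implicit Defensive.

Import Order.TTheory.

Local Open Scope classical_set_scope.
Local Open Scope order_scope.
Local Open Scope card_scope.

(** * Well-orders and climbing sequences *)

Section WellOrders.
Context {d : Order.disp_t} {W : ordinalType d}.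

Lemma ordinal_min (P : W -> Prop) :
  (exists x, P x) -> exists m, P m /\ forall y, P y -> m <= y.
Proof.
move=> [x Px]; have [|m [[Pm mlb] _]] := @le_well_order d W [pred a | `[< P a >]].
  by exists x; apply/asboolP.
exists m; split; first exact/asboolP.
by move=> y Py; apply: mlb; apply/asboolP.
Qed.

Lemma ordinal_ind (P : W -> Prop) :
  (forall x, (forall y, y < x -> P y) -> P x) -> forall x, P x.
Proof.
move=> ih x; apply: contrapT => nPx.
have [m [nPm mmin]] : exists m, ~ P m /\ forall y, ~ P y -> m <= y.
  by apply: ordinal_min; exists x.
apply: nPm; apply: ih => y ym; apply: contrapT => /mmin.
by rewrite leNgt ym.
Qed.

Lemma ordinal_lt_wf : well_founded (fun x y : W => x < y).
Proof. by apply: ordinal_ind => x ih; constructor. Qed.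

(** Transfinite recursion in which each value is only required to satisfy a
    relation to the earlier ones: the values are chosen along the recursion. *)
Lemma ordinal_rec_choice (T : Type) (t0 : T) (R : W -> (W -> T) -> T -> Prop) :
  (forall x f g t, (forall y, y < x -> f y = g y) -> R x f t -> R x g t) ->
  (forall x f, (forall y, y < x -> R y f (f y)) -> exists t, R x f t) ->
  exists f, forall x, R x f (f x).
Proof.
move=> Rext Rex.
pose cut (x : W) (f : forall y, y < x -> T) y :=
  if pselect (y < x) is left yx then f y yx else t0.
pose pick (x : W) (f : forall y, y < x -> T) :=
  if pselect (exists t, R x (cut x f) t) is left e then projT1 (cid e) else t0.
pose f := Fix ordinal_lt_wf (fun=> T) pick.
have fE x : f x = pick x (fun y _ => f y).
  apply: (Fix_eq ordinal_lt_wf (fun=> T) pick) => y g h gh.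
  suff -> : g = h by [].
  by apply: functional_extensionality_dep => z; apply/funext => zy.
exists f; apply: ordinal_ind => x ih.
have [t Rt] := Rex _ _ ih.
have cutE y : y < x -> cut x (fun y _ => f y) y = f y.
  by rewrite /cut; case: pselect.
rewrite fE; apply: (Rext _ (cut x (fun y _ => f y))) => //.
rewrite /pick; case: pselect => [e|[]]; first exact: projT2 (cid e).
by exists t; apply: Rext Rt => y yx; rewrite cutE.
Qed.

Definition climbs (s : nat -> W) (l : W) : Prop :=
  [/\ forall k, s k < s k.+1, forall k, s k < l
    & forall e, e < l -> exists k, e < s k].

Lemma increasing_lt (s : nat -> W) : (forall k, s k < s k.+1) ->
  forall i j, (i < j)%N -> s i < s j.
Proof.
move=> sS i; elim=> // j ih; rewrite ltnS leq_eqVlt => /orP[/eqP ->//|/ih].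
by move=> /lt_trans; apply.
Qed.

Lemma increasing_le (s : nat -> W) : (forall k, s k < s k.+1) ->
  forall i j, (i <= j)%N -> s i <= s j.
Proof.
move=> sS i j; rewrite leq_eqVlt => /orP[/eqP ->//|ij].
by rewrite ltW// (increasing_lt sS).
Qed.

Lemma climbs_near s l e : climbs s l -> e < l -> \forall k \near \oo, e < s k.
Proof.
move=> [sS _ sl] /sl[k ek]; exists k => // j /= kj.
exact: lt_le_trans ek (increasing_le sS kj).
Qed.

Lemma climbs_sub s l (phi : nat -> nat) : climbs s l ->
  (forall k, (phi k < phi k.+1)%N) -> climbs (s \o phi) l.
Proof.
move=> [sS sl scof] phiS; have phik k : (k <= phi k)%N.
  by elim: k => // k ih; apply: leq_ltn_trans ih (phiS k).
split=> [k|k|e /scof[k ek]] /=; [exact: increasing_lt|exact: sl|].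
by exists k; apply: lt_le_trans ek (increasing_le sS (phik k)).
Qed.

Lemma increasing_climbs (s : nat -> W) : (forall k, s k < s k.+1) ->
  (exists b, forall k, s k <= b) -> exists l, climbs s l.
Proof.
move=> sS /ordinal_min[l [sl lmin]]; exists l; split=> // [k|e el].
  exact: lt_le_trans (sS k) (sl _).
apply: contrapT => nk; suff /lmin : forall k, s k <= e by rewrite leNgt el.
by move=> k; rewrite leNgt; apply/negP => ek; apply: nk; exists k.
Qed.

End WellOrders.

Lemma nat_well_order : well_order (@Order.le _ nat).
Proof.
apply: antisymmetric_well_order; first exact: le_anti.
by move=> A An; have [m Am mlb] := ex_minnP An; exists m.
Qed.

HB.instance Definition _ := Order_isWellOrder.Build _ nat nat_well_order.

Section Subordinal.
Context {d : Order.disp_t} {W : ordinalType d} (P : pred W).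

Definition subordinal := {x : W | P x}.

HB.instance Definition _ := SubType.on subordinal.
HB.instance Definition _ := [Choice of subordinal by <:].
HB.instance Definition _ := [SubChoice_isSubOrder of subordinal by <: with d].

Lemma subordinal_well_order : well_order (@Order.le _ subordinal).
Proof.
apply: antisymmetric_well_order; first exact: le_anti.
move=> A [x Ax]; have [|m [[y Ay ym] mmin]] := @ordinal_min d W
  (fun w => exists2 y : subordinal, y \in A & val y = w).
  by exists (val x), x.
by exists y; split=> // z Az; rewrite leEsub ym; apply: mmin; exists z.
Qed.

HB.instance Definition _ :=
  Order_isWellOrder.Build _ subordinal subordinal_well_order.
End Subordinal.

(** Countable cofinality: an enumeration of the predecessors of [a] is used to
    push the sequence above each of them. *)
Lemma climbs_within d (V : ordinalType d) (a : V) (P : V -> Prop) :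
  countable [set b | b < a] -> (exists2 l, l < a & P l) ->
  (forall e, e < a -> exists l, [/\ e < l, l < a & P l]) ->
  exists2 t, climbs t a & forall k, P (t k).
Proof.
move=> /pfcard_geP[a0|[f]] [l0 la Pl] Pcof.
  have : [set b | b < a] l0 by [].
  by rewrite a0.
have /choice[next nextP] : forall kl : nat * V, exists l, kl.2 < a ->
    [/\ Order.max kl.2 (f kl.1) < l, l < a & P l].
  move=> [k l]; have [la'|] := boolP (l < a); last by exists a.
  have fa : f k < a by have : [set b | b < a] (f k) by apply: funS.
  have [|l' [ml' l'a Pl']] := Pcof (Order.max l (f k)); first by rewrite gt_max la'.
  by exists l'.
pose t := fix t k := if k is j.+1 then next (j, t j) else l0.
have ta k : t k < a by elim: k => // k tk /=; have [] := nextP (k, t k) tk.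
exists t; last by case=> // k /=; have [] := nextP (k, t k) (ta k).
split=> // [k|e ea].
  by have [+ _ _] := nextP (k, t k) (ta k); rewrite gt_max => /andP[].
have [k _ <-] := 'surj_f (ea : [set b | b < a] e); exists k.+1.
by have [+ _ _] := nextP (k, t k) (ta k); rewrite gt_max => /andP[].
Qed.

(** * Unsplit subsequences of a nested family of sets of naturals *)

Definition settled (s : nat -> bool) := exists b, \forall k \near \oo, s k = b.

(** For an index set of size less than the bounding number this always holds; it
    is the only form in which that number is used. *)
Definition dominable (I : Type) (S : I -> Prop) := forall h : I -> nat -> nat,
  exists g, forall i, S i -> eventually_dominated (h i) g.

Definition infinitely_often (D : nat -> Prop) :=
  forall N, exists2 k, (N <= k)%N & D k.

Lemma infinitely_often_enum (D : nat -> Prop) : infinitely_often D ->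
  exists phi : nat -> nat, (forall k, (phi k < phi k.+1)%N) /\ forall k, D (phi k).
Proof.
move=> infD; have /choice[next nextP] : forall N, exists k, (N <= k)%N /\ D k.
  by move=> N; have [k] := infD N; exists k.
exists (fun k => iter k (next \o S) (next 0)); split=> k /=.
  exact: (nextP _).1.
by case: k => [|k]; exact: (nextP _).2.
Qed.

Section Unsplit.
Context {d : Order.disp_t} {W : ordinalType d}.
Variables (S : W -> Prop) (u : W -> nat -> bool).
Hypothesis smallS : dominable S.
Hypothesis nested : forall i j, S i -> S j -> i < j ->
  exists b, \forall k \near \oo, u j k -> u i k = b.

Let unsplit i (D : nat -> Prop) := exists b, \forall k \near \oo, D k -> u i k = b.

Let unsplit_sub i (D E : nat -> Prop) :
  (\forall k \near \oo, E k -> D k) -> unsplit i D -> unsplit i E.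
Proof.
by move=> ED [b Db]; exists b; apply: filterS2 ED Db => k ED Db /ED.
Qed.

Let split_often i (D : nat -> Prop) b : ~ unsplit i D ->
  infinitely_often (fun k => D k /\ u i k = b).
Proof.
move=> nspl N; apply: contrapT => noD; apply: nspl; exists (~~ b), N => // k /= Nk Dk.
apply/eqP; rewrite -[_ == _]negbK; apply/negP => uk; apply: noD.
by exists k => //; split=> //; case: (u i k) b uk => [] [].
Qed.

(** If each infinite set were split by the family, let [D 0] be everything and
    [D n.+1] be [D n] minus the first member [f n] of the family that splits it.
    The parts of [D n] inside [f n] are infinite and disjoint; the set [R] picks one
    element of each, far out in the sense given by domination.  Then no member
    [j] splits [R].  If [j] is not after all the [f n], it does not split some
    [D n.+1], which contains almost all of [R].  If [j] is after all of them and
    almost contained in some [f n], it is almost disjoint from [D n.+1], hence from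
    [R].  Otherwise [j] is almost disjoint from each [f n], and [R] was picked beyond
    these finite intersections. *)
Lemma unsplit_infinite : exists2 D, infinitely_often D & forall i, S i -> unsplit i D.
Proof.
apply: contrapT => nD.
have split_min D : infinitely_often D -> exists i,
    [/\ S i, ~ unsplit i D & forall j, j < i -> S j -> unsplit j D].
  move=> infD; have [|i [[Si spl] imin]] := @ordinal_min _ W
      (fun i => S i /\ ~ unsplit i D).
    apply: contrapT => nosp; apply: nD; exists D => // i Si.
    by apply: contrapT => spl; apply: nosp; exists i.
  exists i; split=> // j ji Sj; apply: contrapT => nsp.
  by have := imin j (conj Sj nsp); rewrite leNgt ji.
have [i0 _] : exists i, S i.
  have [|i [Si _ _]] := split_min (fun=> True); last by exists i.
  by move=> N; exists N.
have /choice[first firstP] D : exists i, infinitely_often D ->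
    [/\ S i, ~ unsplit i D & forall j, j < i -> S j -> unsplit j D].
  by have [/split_min[i]|] := pselect (infinitely_often D); [exists i|exists i0].
pose D := fix D n := if n is m.+1
  then fun k => D m k /\ u (first (D m)) k = false else fun=> True.
pose f n := first (D n).
have infD n : infinitely_often (D n).
  elim: n => [|n /firstP[_ spl _]] /=; first by move=> N; exists N.
  exact: split_often spl.
have fS n : S (f n) by have [] := firstP _ (infD n).
have fspl n : ~ unsplit (f n) (D n) by have [] := firstP _ (infD n).
have fmin n j : j < f n -> S j -> unsplit j (D n).
  by have [_ _] := firstP _ (infD n); apply.
have Dsub m n k : (m <= n)%N -> D n k -> D m k.
  elim: n => [|n ih]; first by rewrite leqn0 => /eqP ->.
  by rewrite leq_eqVlt => /orP[/eqP ->//|/ih mn] [/mn].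
have /choice[p pP] : forall ni : nat * nat, exists k,
    (ni.2 <= k)%N /\ (D ni.1 k /\ u (f ni.1) k = true).
  by move=> [n i]; have [k ik Dk] := split_often true (fspl n) i; exists k.
have /choice[h hP] : forall j, exists h : nat -> nat, forall n,
    (\forall k \near \oo, u j k -> u (f n) k = false) ->
    forall k, (h n <= k)%N -> u (f n) k -> u j k = false.
  move=> j; suff /choice[h hP] : forall n, exists N : nat,
      (\forall k \near \oo, u j k -> u (f n) k = false) ->
      forall k, (N <= k)%N -> u (f n) k -> u j k = false by exists h.
  move=> n.
  have [[N _ Nu]|] := pselect (\forall k \near \oo, u j k -> u (f n) k = false).
    by exists N => _ k Nk ufk; apply/negP => /(Nu k Nk); rewrite ufk.
  by exists 0%N.
have [g gP] := smallS h.
pose q n := p (n, maxn (g n) n).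
(* The maximum with [n] makes [R] infinite. *)
pose R k := exists n, k = q n.
have nq n : (n <= q n)%N.
  by apply: leq_trans (pP (n, maxn (g n) n)).1; rewrite leq_maxr.
have gq n : (g n <= q n)%N.
  by apply: leq_trans (pP (n, maxn (g n) n)).1; rewrite leq_maxl.
have Rnear (P : nat -> Prop) : (\forall n \near \oo, P (q n)) ->
    \forall k \near \oo, R k -> P k.
  move=> [N _ NP]; exists (\max_(n < N) q n).+1 => // k /= Nk [n kq].
  rewrite kq; apply: NP => /=; rewrite leqNgt; apply/negP => nN.
  by move: Nk; rewrite kq ltnNge (leq_bigmax (Ordinal nN)).
have qD n m : (n <= m)%N -> D n (q m).
  by move=> nm; apply: (Dsub _ m) => //; have [_ []] := pP (m, maxn (g m) m).
have qu n : u (f n) (q n) by have [_ []] := pP (n, maxn (g n) n).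
apply: nD; exists R => [N|j Sj]; first by exists (q N) => //; exists N.
have [[n nj]|jf] := pselect (exists n, j <= f n).
  apply: (unsplit_sub (D := D n.+1)).
    by apply: Rnear; exists n.+1 => // m /=; exact: qD.
  move: nj; rewrite le_eqVlt => /orP[/eqP ->|/fmin/(_ Sj)].
    by exists false; apply: nearW => k [].
  by apply: unsplit_sub; apply: nearW => k [].
have {}jf n : f n < j by rewrite ltNge; apply/negP => nj; apply: jf; exists n.
exists false; apply: Rnear.
have [[n nu]|nu] := pselect (exists n, \forall k \near \oo, u j k -> u (f n) k = true).
  have [N _ NP] := nu; exists (maxn N n.+1) => // m /=; rewrite geq_max => /andP[Nm nm].
  apply/negP => uj; have := NP (q m) (leq_trans Nm (nq m)) uj.
  by have [_ ->] := qD _ _ nm.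
have [N _ NP] := gP j Sj; exists N => // n /= Nn.
apply: (hP j n) (leq_trans (NP n Nn) (gq n)) (qu n).
have [[] bP] := nested (fS n) Sj (jf n); last exact: bP.
by case: nu; exists n.
Qed.

Lemma unsplit_subsequence : exists phi : nat -> nat,
  (forall k, (phi k < phi k.+1)%N) /\ forall i, S i -> settled (u i \o phi).
Proof.
have [D /infinitely_often_enum[phi [phiS Dphi]] Du] := unsplit_infinite.
have phik k : (k <= phi k)%N.
  by elim: k => // k ih; apply: leq_ltn_trans ih (phiS k).
exists phi; split=> // i /Du[b [N _ Nb]]; exists b, N => // k /= Nk.
by apply: Nb (Dphi k); exact: leq_trans Nk (phik k).
Qed.
End Unsplit.

(** * Splitting double climbs: the family attached to one level *)

Section LeftConstant.
Context {d : Order.disp_t} {V : ordinalType d}.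
Implicit Types (x y e a : V) (U : V -> bool).

(** The second clause only concerns the least element, which has nothing below. *)
Definition just_below e x := e < x \/ forall y, x <= y.

Lemma just_below_ex x : exists e, just_below e x.
Proof.
have [[e ex]|nx] := pselect (exists e, e < x); first by exists e; left.
exists x; right=> y; rewrite leNgt; apply/negP => yx; apply: nx.
by exists y.
Qed.

Lemma just_below_lt e x y : just_below e x -> y < x -> e < x.
Proof. by move=> [//|xmin]; rewrite ltNge xmin. Qed.

(** For sets of ordinals, this at every point of [a] means being clopen in [a]. *)
Definition left_constant U x :=
  exists2 e, just_below e x & forall y, e < y -> y <= x -> U y = U x.

(** The intervals [(lo n, hi n]] are clopen and form a locally finite family. *)
Lemma left_constant_intervals (lo hi : nat -> V) x :
  (forall n, lo n < hi n) -> (forall n, hi n < lo n.+1) ->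
  (exists n, x <= hi n) ->
  left_constant (fun y => `[< exists n, lo n < y <= hi n >]) x.
Proof.
move=> lohi hilo xhi.
have loS n : lo n < lo n.+1 by exact: lt_trans (lohi n) (hilo n).
have hiS n : hi n < hi n.+1 by exact: lt_trans (hilo n) (lohi n.+1).
have [[n /andP[lox xhin]]|xout] := pselect (exists n, lo n < x <= hi n).
  exists (lo n); first by left.
  move=> y loy yx; transitivity true.
    by apply/asboolP; exists n; rewrite loy (le_trans yx).
  by apply/esym/asboolP; exists n; rewrite lox.
case: (ex_minnP xhi) => n xhin nmin.
have xlo : x <= lo n.
  by rewrite leNgt; apply/negP => lox; apply: xout; exists n; rewrite lox.
have [e ex he] : exists2 e, just_below e x &
    forall m y, (m < n)%N -> e < y -> hi m < y.
  case: n nmin {xhin xlo} => [|n] nmin.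
    by have [e ex] := just_below_ex x; exists e.
  exists (hi n); first by left; rewrite ltNge; apply/negP => /nmin; rewrite ltnn.
  move=> m y mn hy; exact: le_lt_trans (increasing_le hiS (mn : (m <= n)%N)) hy.
exists e => // y ey yx; transitivity false.
  apply/negbTE/negP => /asboolP[m /andP[loy yhi]].
  have [mn|nm] := ltnP m n; first by move: yhi; rewrite leNgt (he _ _ mn).
  have := le_trans yx (le_trans xlo (increasing_le loS nm)).
  by rewrite leNgt loy.
by apply/esym/negbTE/negP => /asboolP.
Qed.

Definition nested_below a U U' :=
  exists b e, just_below e a /\ forall y, e < y -> U' y -> U y = b.

(** The levels along an [omega^2]-sequence, with the limits listed by [l]. *)
Definition double_climb a (c : nat -> nat -> V) (l : nat -> V) :=
  [/\ forall n, climbs (c n) (l n), forall n, l n < c n.+1 0%N & climbs l a].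

Definition steady U (c : nat -> nat -> V) (l : nat -> V) :=
  exists b, \forall n \near \oo, U (l n) = b /\ forall k, U (c n k) = b.

Section SplittingSet.
Variables (I : Type) (S : I -> Prop) (F : I -> V -> bool) (t : I -> nat -> V).
Variables (a : V) (c : nat -> nat -> V) (l : nat -> V).
Hypothesis smallS : dominable S.
Hypothesis Fleft : forall i, S i -> forall x, x < a -> left_constant (F i) x.
Hypothesis cl : double_climb a c l.
Hypothesis Fsteady : forall i, S i -> steady (F i) c l.

(** The set is a union of intervals [(c n k, c n k.+1]] with [k = g n].  It contains
    [c n (g n).+1] and omits [l n] for each [n], so it splits [c] whatever [g] is;
    the growth of [g] takes care of the sets [F i] and of the sequences [t i].  For
    fixed [n], the intervals converge to [l n], at which [F i] is locally
    constant from the left, and below which [t i] has finitely many terms. *)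
Lemma splitting_set : exists U,
  [/\ forall x, U x -> x < a, forall x, x < a -> left_constant U x,
      ~ steady U c l,
      forall i, S i -> nested_below a (F i) U
    & forall i, S i -> climbs (t i) a -> \forall k \near \oo, U (t i k) = false].
Proof.
have [cn lc [lS la lcof]] := cl.
have cS n k : c n k < c n k.+1 by have [] := cn n.
have cl' n k : c n k < l n by have [] := cn n.
have /choice[h hP] : forall i, exists h : nat -> nat, forall n, S i -> forall k,
    (h n <= k)%N -> forall y, c n k < y -> y <= c n k.+1 ->
    F i y = F i (l n) /\ (climbs (t i) a -> forall j, t i j <> y).
  move=> i; suff /choice[h hP] : forall n, exists N : nat, S i -> forall k,
      (N <= k)%N -> forall y, c n k < y -> y <= c n k.+1 ->
      F i y = F i (l n) /\ (climbs (t i) a -> forall j, t i j <> y) by exists h.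
  move=> n; have [Si|] := pselect (S i); last by exists 0%N.
  suff [N _ NP] : \forall k \near \oo, forall y, c n k < y -> y <= c n k.+1 ->
    F i y = F i (l n) /\ (climbs (t i) a -> forall j, t i j <> y) by exists N.
  have [e eln eF] := Fleft Si (la n).
  have Fk := climbs_near (cn n) (just_below_lt eln (cl' n 0%N)).
  have tk : \forall k \near \oo, climbs (t i) a -> forall j, t i j < l n -> t i j < c n k.
    have [ti|nti] := pselect (climbs (t i) a); last by apply: nearW => k /nti.
    have [m lm] : exists m, l n < t i m by have [_ _] := ti; apply.
    have : forall m, \forall k \near \oo,
        forall j, (j < m)%N -> t i j < l n -> t i j < c n k.
      elim=> [|m' ih]; first exact: nearW.
      have : \forall k \near \oo, t i m' < l n -> t i m' < c n k.
        have [tl|ntl] := boolP (t i m' < l n); last exact: nearW.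
        by apply: filterS (climbs_near (cn n) tl) => k ? _.
      apply: filterS2 ih => k km km' j; rewrite ltnS leq_eqVlt.
      by move=> /orP[/eqP ->|/km].
    move=> /(_ m); apply: filterS => k kP _ j tj; apply: kP => //.
    rewrite ltnNge; apply/negP => mj; have [tS _ _] := ti.
    by have := lt_le_trans lm (increasing_le tS mj); rewrite ltNge (ltW tj).
  apply: filterS2 Fk tk => k ek tk y cy yc; split=> [|ti j tj].
    apply: eF; first exact: lt_trans ek cy.
    exact: le_trans yc (ltW (cl' n k.+1)).
  have := tk ti j; rewrite tj => /(_ (le_lt_trans yc (cl' n k.+1))).
  by rewrite ltNge (ltW cy).
have [g gP] := smallS h.
pose lo n := c n (g n); pose hi n := c n (g n).+1.
have lohi n : lo n < hi n by exact: cS.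
have lle n m : (n < m)%N -> l n < lo m.
  case: m => // m nm; apply: le_lt_trans (increasing_le lS (nm : (n <= m)%N)) _.
  by apply: lt_le_trans (lc m) _; apply: increasing_le.
have hil n : hi n < l n by exact: cl'.
have hilo n : hi n < lo n.+1 by exact: lt_trans (hil n) (lle _ _ _).
have inter n m y : lo m < y <= hi m -> l n < y -> (n < m)%N.
  move=> /andP[_ yhi] ly; rewrite ltnNge; apply/negP => mn.
  have := lt_le_trans ly yhi; rewrite ltNge; apply/negP/negPn/ltW.
  exact: lt_le_trans (hil m) (increasing_le lS mn).
exists (fun y => `[< exists n, lo n < y <= hi n >]); split.
- move=> x /asboolP[n /andP[_ xhi]]; apply: le_lt_trans xhi _.
  exact: lt_trans (hil n) (la n).
- move=> x xa; apply: left_constant_intervals => //.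
  have [n xl] := lcof x xa; exists n.+1; apply/ltW/(lt_trans xl).
  by apply: lt_trans (lle _ _ _) (lohi _).
- move=> [b [N _ NP]]; have [Nl /(_ (g N).+1)] := NP N (leqnn N).
  have -> : `[< exists n, lo n < c N (g N).+1 <= hi n >] = true.
    by apply/asboolP; exists N; rewrite lohi /=.
  move=> bE; move: Nl; rewrite -bE => /asboolP[m lm].
  have [mN|Nm] := ltnP N m.
    by move: lm => /andP[]; rewrite ltNge (ltW (lle _ _ mN)).
  move: lm => /andP[_]; rewrite leNgt => /negP; apply.
  exact: lt_le_trans (hil m) (increasing_le lS Nm).
- move=> i Si; have [b [N _ NP]] := Fsteady Si; have [M _ MP] := gP i Si.
  exists b, (l (maxn N M)); split; first by left.
  move=> y ly /asboolP[n yn]; have := inter _ _ _ yn ly; rewrite gtn_max.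
  move=> /andP[/ltnW Nn /ltnW Mn]; move: yn => /andP[lo_y y_hi].
  by have [-> _] := hP i n Si _ (MP n Mn) y lo_y y_hi; exact: (NP n Nn).1.
- move=> i Si ti; have [M _ MP] := gP i Si.
  apply: filterS (climbs_near ti (la M)) => k lt.
  apply/negbTE/negP => /asboolP[n yn].
  have Mn := ltnW (inter _ _ _ yn lt); move: yn => /andP[lo_y y_hi].
  by have [_ /(_ ti k)] := hP i n Si _ (MP n Mn) _ lo_y y_hi; apply.
Qed.
End SplittingSet.
End LeftConstant.

Section Ladder.
Context {d : Order.disp_t} {V : ordinalType d}.
Context {d' : Order.disp_t} {W : ordinalType d'}.

(** The last two clauses pull in opposite directions: simple sequences must keep an
    unsplit subsequence, but double climbs must be split. *)
Definition ladder (a : V) (U : W -> V -> bool) : Prop :=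
  [/\ forall i x, U i x -> x < a,
      forall i x, x < a -> left_constant (U i) x,
      forall i j, i < j -> nested_below a (U i) (U j),
      forall t, climbs t a -> exists phi : nat -> nat,
        (forall k, (phi k < phi k.+1)%N) /\ forall i, settled (U i \o t \o phi)
    & forall c l, double_climb a c l -> exists i, ~ steady (U i) c l].

Hypothesis smallW : forall j : W, dominable (fun i => i < j).

Lemma dominable_le (j : W) : dominable (fun i => i <= j).
Proof.
move=> h; have [g gP] := smallW j h.
exists (fun n => maxn (g n) (h j n)) => i; rewrite le_eqVlt => /orP[/eqP ->|/gP].
  by apply: nearW => n; rewrite leq_maxr.
by apply: filterS => n /leq_trans; apply; rewrite leq_maxl.
Qed.

Variables (a : V) (e : W -> nat -> V).
Hypothesis e_onto : forall t, (forall k, t k < a) -> exists i, e i = t.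

(** Each [e i] is read twice, as a simple sequence and as the code of a double
    one: the entry coded by [(n, 0)] is the limit of row [n]. *)
Let c i (n k : nat) := e i (choice.pickle (n, k.+1)).
Let l i (n : nat) := e i (choice.pickle (n, 0%N)).

(** The value at [j] is a pair of a set and a promised subsequence of [e j].  The
    third clause keeps the promises made before [j]: the new set is almost disjoint
    from the earlier promised subsequences, which therefore stay unsplit. *)
Let stage (j : W) (f : W -> (V -> bool) * (nat -> V)) (Ut : (V -> bool) * (nat -> V)) :=
  [/\ (forall x, Ut.1 x -> x < a) /\ (forall x, x < a -> left_constant Ut.1 x),
      forall i, i < j -> nested_below a (f i).1 Ut.1,
      forall i, i < j -> climbs (f i).2 a ->
        \forall k \near \oo, Ut.1 ((f i).2 k) = false,
      double_climb a (c j) (l j) ->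
        (exists2 i, i < j & ~ steady (f i).1 (c j) (l j)) \/
        ~ steady Ut.1 (c j) (l j)
    & climbs (e j) a -> exists phi : nat -> nat,
        [/\ forall k, (phi k < phi k.+1)%N, Ut.2 = e j \o phi,
            settled (Ut.1 \o Ut.2)
          & forall i, i < j -> settled ((f i).1 \o Ut.2)]].

Let stage_ext j f g Ut : (forall i, i < j -> f i = g i) ->
  stage j f Ut -> stage j g Ut.
Proof.
move=> fg [U1 U2 U3 U4 U5]; split=> //.
- by move=> i ij; rewrite -fg//; exact: U2.
- by move=> i ij; rewrite -fg//; exact: U3.
- by move=> /U4[[i ij]|]; [rewrite fg//; left; exists i|right].
- move=> /U5[phi [p1 p2 p3 p4]]; exists phi; split=> // i ij.
  by rewrite -fg//; exact: p4.
Qed.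

(** When [c j] is already split, or is not a double climb, the empty set is added;
    otherwise [splitting_set] applies, since [j] has fewer than [b] predecessors. *)
Let stage_ex j f : (forall i, i < j -> stage i f (f i)) ->
  exists Ut, stage j f Ut.
Proof.
move=> ih.
have [U [Ua Uleft Unest Ut Usplit]] : exists U : V -> bool,
  [/\ forall x, U x -> x < a, forall x, x < a -> left_constant U x,
      forall i, i < j -> nested_below a (f i).1 U,
      forall i, i < j -> climbs (f i).2 a ->
        \forall k \near \oo, U ((f i).2 k) = false
    & double_climb a (c j) (l j) ->
        (exists2 i, i < j & ~ steady (f i).1 (c j) (l j)) \/
        ~ steady U (c j) (l j)].
  have [[cl ns]|triv] := pselect (double_climb a (c j) (l j) /\
      ~ exists2 i, i < j & ~ steady (f i).1 (c j) (l j)).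
    have fleft i : i < j -> forall x, x < a -> left_constant (f i).1 x.
      by move=> /ih[[]].
    have fsteady i : i < j -> steady (f i).1 (c j) (l j).
      by move=> ij; apply: contrapT => nsi; apply: ns; exists i.
    have [U [U1 U2 U3 U4 U5]] := splitting_set (fun i => (f i).2)
      (smallW j) fleft cl fsteady.
    by exists U; split=> // _; right.
  exists (fun=> false); split=> //.
  - by move=> x _; have [y yx] := just_below_ex x; exists y.
  - by move=> i _; have [y ya] := just_below_ex a; exists true, y.
  - by move=> i _ _; exact: nearW.
  - by move=> cl; left; apply: contrapT => ns; apply: triv.
have [ce|nce] := pselect (climbs (e j) a); last first.
  by exists (U, e j); split.
pose u i := (if i == j then U else (f i).1) \o e j.
have uj : u j = U \o e j by rewrite /u eqxx.
have ui i : i < j -> u i = (f i).1 \o e j by move=> /lt_eqF ij; rewrite /u ij.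
have unest i k : i < k -> k <= j ->
    exists b, \forall n \near \oo, u k n -> u i n = b.
  move=> ik kj; have [b [x [xa xP]]] : nested_below a
      (if i == j then U else (f i).1) (if k == j then U else (f k).1).
    rewrite (lt_eqF (lt_le_trans ik kj)); have [kE|kneq] := eqVneq k j.
      by apply: Unest; rewrite -kE.
    have kj' : k < j by rewrite lt_neqAle kneq.
    by have [_ + _ _ _] := ih k kj'; exact.
  have xa' : x < a by case: ce => _ /(_ 0%N) e0 _; exact: just_below_lt xa e0.
  exists b.
  by apply: filterS (climbs_near ce xa') => n xn; exact: xP.
have [|phi [phiS phiu]] := unsplit_subsequence (u := u) (@dominable_le j).
  by move=> i k _ kj ik; exact: unest.
exists (U, e j \o phi); split=> // _; exists phi; split=> //=.
  by have := phiu j (lexx j); rewrite uj.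
by move=> i ij; have := phiu i (ltW ij); rewrite ui.
Qed.

(** A simple sequence is some [e j].  Its promised subsequence is unsplit by the
    sets up to [j] by choice, and by the later ones because they almost avoid it. *)
Lemma ladder_exists : exists U, ladder a U.
Proof.
have [f fP] := ordinal_rec_choice ((fun=> false), (fun=> a)) stage_ext stage_ex.
exists (fun i => (f i).1); split.
- by move=> i; have [[]] := fP i.
- by move=> i; have [[]] := fP i.
- by move=> i j ij; have [_ + _ _ _] := fP j; exact.
- move=> t ct; have [j ej] : exists j, e j = t.
    by apply: e_onto; case: ct.
  have [_ _ _ _] := fP j; rewrite ej => /(_ ct)[phi [phiS ft fset fset']].
  exists phi; split=> // i; have [ij|ji|->] := ltgtP i j.
  - by have := fset' i ij; rewrite ft.
  - have [_ _ + _ _] := fP i => /(_ j ji); rewrite ft => /(_ (climbs_sub ct phiS)).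
    by exists false.
  - by rewrite ft in fset.
- move=> c' l' cl.
  pose t m := if choice.unpickle m is Some (n, k) then
    if k is k'.+1 then c' n k' else l' n else l' 0%N.
  have [j ej] : exists j, e j = t.
    apply: e_onto => m; have [cn _ [_ la _]] := cl; rewrite /t.
    case: choice.unpickle => [[n [|k]]|] //.
    by have [_ + _] := cn n => /(_ k)/lt_trans; apply.
  have cE : c j = c'.
    by apply/funext => n; apply/funext => k; rewrite /c ej /t choice.pickleK.
  have lE : l j = l' by apply/funext => n; rewrite /l ej /t choice.pickleK.
  have [_ _ _ + _] := fP j; rewrite cE lE => /(_ cl)[[i _ si]|sj].
    by exists i.
  by exists j.
Qed.
End Ladder.

(** * The cardinal hypotheses *)

Lemma omega0_countable d (V : ordinalType d) :
  is_omega 0 V -> countable [set: V].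
Proof.
move=> [_ finV]; pose r (a : V) := #|` fset_set [set b | b < a]|%fset.
have rlt a b : a < b -> (r a < r b)%N.
  move=> ab; apply: fproper_ltn_card; apply/andP; split.
    apply/fsubsetP => x; rewrite !in_fset_set// => /set_mem xa.
    exact/mem_set/(lt_trans xa).
  apply/fsubsetPn; exists a; rewrite in_fset_set//; first exact/mem_set.
  by apply/negP => /set_mem /=; rewrite ltxx.
apply/countable_injP; exists r => a b _ _ rab.
by have [/rlt|/rlt|//] := ltgtP a b; rewrite rab ltnn.
Qed.

Lemma omega1_uncountable d (V : ordinalType d) :
  is_omega 1 V -> ~ countable [set: V].
Proof.
move=> [d0 [V0 [[infV0 _] nV _]]] cV; apply: nV; apply: card_le_trans cV _.
exact/infiniteP.
Qed.

Lemma omega1_initial_countable d (V : ordinalType d) (a : V) :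
  is_omega 1 V -> countable [set b | b < a].
Proof.
move=> [d0 [V0 [V0P _ /(_ a) aV0]]]; apply: sub_countable aV0 _.
exact: omega0_countable.
Qed.

(** Regularity of [omega_1]: otherwise it would be a countable union of countable
    initial segments. *)
Lemma omega1_sequence_bounded d (V : ordinalType d) (s : nat -> V) :
  is_omega 1 V -> exists b, forall k, s k < b.
Proof.
move=> V1; apply: contrapT => nb; apply: (omega1_uncountable V1).
pose F (kb : nat * bool) := if kb.2 then [set s kb.1] else [set b | b < s kb.1].
apply: (@sub_countable _ _ _ (\bigcup_kb F kb)).
  apply: subset_card_le => b _; apply: contrapT => nbs; apply: nb.
  exists b => k; rewrite ltNge le_eqVlt; apply/negP => /orP[/eqP bs|bs].
    by apply: nbs; exists (k, true).
  by apply: nbs; exists (k, false).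
apply: bigcup_countable => // -[k [|]] _; rewrite /F //=.
exact: omega1_initial_countable.
Qed.

(** A set of functions with fewer elements than [b] is bounded. *)
Lemma bounding_dominable d (W : ordinalType d) d' (V : ordinalType d')
    (S : W -> Prop) :
  is_bounding_number W -> ~ ([set: W] #<= [set: V]) ->
  [set i | S i] #<= [set: V] -> dominable S.
Proof.
move=> [_ bW] nWV SV h; apply: contrapT => nh; apply: nWV.
apply: card_le_trans SV; apply: card_le_trans (card_image_le h _).
apply: bW => -[g gP]; apply: nh; exists g => i Si; apply: gP.
by exists i.
Qed.

(** There are continuum many sequences in a countable set: a binary sequence is
    read as the characteristic function of the graph of a map from [nat] to [nat],
    and [f] enumerates the predecessors of [a]. *)
Lemma continuum_enumerates d (W : ordinalType d) d' (V : ordinalType d') (a : V) :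
  is_continuum W -> countable [set b | b < a] ->
  exists e : W -> nat -> V,
    forall t, (forall k, t k < a) -> exists i, e i = t.
Proof.
move=> Wc /pfcard_geP[a0|[f]].
  exists (fun _ _ => a) => t /(_ 0%N) ta.
  have : [set b | b < a] (t 0%N) by [].
  by rewrite a0.
have /pcard_surjP[g gsurj] : [set: nat -> bool] #<= [set: W].
  by move: Wc; rewrite /is_continuum card_eq_le => /andP[].
pose decode (s : nat -> bool) (n : nat) := xget 0%N [set k | s (choice.pickle (n, k))].
exists (fun i n => f (decode (g i) n)) => t ta.
have /choice[m mt] : forall n, exists k, f k = t n.
  move=> n; have tan : [set b | b < a] (t n) by exact: ta.
  by have [k _ fk] := 'surj_f tan; exists k.
have [i _ gi] := gsurj (fun x =>
  if choice.unpickle x is Some (n, k) then k == m n else false) I.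
exists i; apply/funext => n; rewrite -mt; congr (f _).
rewrite /decode gi; apply: xget_subset1; first by rewrite /= choice.pickleK.
by move=> x y /=; rewrite !choice.pickleK => /eqP -> /eqP ->.
Qed.

(** * Closures in the Cantor cube of a set of indices *)

Section PointwiseClosure.
Variable I : choiceType.
Local Notation cube := (prod_topology (fun _ : I => bool)).

Definition agree (s : seq I) (p q : I -> bool) := {in s, p =1 q}.

(** Basic neighbourhoods are given by finitely many coordinates, listed in [s]. *)
Lemma cube_nbhsP (p : cube) (N : set cube) :
  nbhs p N <-> exists s, forall q, agree s q p -> N q.
Proof.
split.
  pose F : set_system cube := fun M => exists s, forall q, agree s q p -> M q.
  have FF : Filter F.
    split; first by exists [::].
      move=> P Q [s sP] [t tQ]; exists (s ++ t) => q qp; split.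
        by apply: sP => i si; apply: qp; rewrite mem_cat si.
      by apply: tQ => i ti; apply: qp; rewrite mem_cat ti orbT.
    by move=> P Q PQ [s sP]; exists s => q /sP/PQ.
  have : F --> p.
    apply/cvg_sup => i M [Q [[B _ <-] /= Bp] BM].
    by exists [:: i] => q qp; apply: BM => /=; rewrite /= qp// inE.
  exact.
move=> [s sN]; apply: (filterS (P := [set q : cube | agree s q p])).
  by move=> q; exact: sN.
elim: s {sN} => [|i s ih].
  by apply: filterS filterT => q _ i; rewrite in_nil.
have ni : nbhs p [set q : cube | q i = p i].
  have := @proj_continuous I (fun=> bool) i p [set b | b = p i].
  by apply; rewrite nbhs_principalE; exact/principal_filterP.
by apply: filterS2 ni ih => q qi qs j; rewrite inE => /orP[/eqP ->//|/qs].
Qed.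

Variable E : set (I -> bool).

Definition approximable (p : I -> bool) :=
  forall s, exists2 q, E q & agree s q p.

Lemma closure_cubeP (p : cube) : closure (E : set cube) p <-> approximable p.
Proof.
split=> [clp s|ap N /cube_nbhsP[s sN]].
  have [q [Eq qp]] : E `&` [set q | agree s q p] !=set0.
    by apply: clp; apply/cube_nbhsP; exists s.
  by exists q.
by have [q Eq /sN] := ap s; exists q.
Qed.

Lemma approximable_limit (p : I -> bool) :
  (forall s, exists2 q, approximable q & agree s q p) -> approximable p.
Proof.
move=> ap s; have [q /(_ s)[r Er rq] qp] := ap s.
by exists r => // i si; rewrite rq// qp.
Qed.

Definition pointwise_closure : topologicalType := set_type (closure (E : set cube)).

Definition coord (x : pointwise_closure) : I -> bool := set_val x.

Lemma coord_approximable x : approximable (coord x).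
Proof. by apply/closure_cubeP; exact/set_mem/(valP x). Qed.

Lemma coord_inj : injective coord.
Proof. exact: val_inj. Qed.

Lemma coord_surj p : approximable p -> exists x, coord x = p.
Proof.
move=> /closure_cubeP clp.
by exists (exist (fun q => q \in closure (E : set cube)) p (mem_set clp)).
Qed.

Lemma pointwise_closure_nbhsP (x : pointwise_closure) (N : set pointwise_closure) :
  nbhs x N <-> exists s, forall y, agree s (coord y) (coord x) -> N y.
Proof.
split=> [[Q [[B Bop <-] /= Bx] BN]|[s sN]].
  have /cube_nbhsP[s sB] : nbhs (set_val x : cube) B by apply: open_nbhs_nbhs; split.
  by exists s => y yx; apply: BN; exact: sB.
have : nbhs (set_val x : cube) [set q : cube | agree s q (coord x)].
  by apply/cube_nbhsP; exists s.
rewrite nbhsE => -[B [Bop Bx] BN].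
exists (set_val @^-1` B); first by split=> //; exists B.
by move=> y By; apply: sN; exact: BN.
Qed.

Lemma pointwise_closure_closureP (A : set pointwise_closure) x :
  closure A x <-> forall s, exists2 y, A y & agree s (coord y) (coord x).
Proof.
split=> [clx s|ax N /pointwise_closure_nbhsP[s sN]].
  have [y [Ay yx]] : A `&` [set y | agree s (coord y) (coord x)] !=set0.
    by apply: clx; apply/pointwise_closure_nbhsP; exists s.
  by exists y.
by have [y Ay /sN] := ax s; exists y.
Qed.

Lemma pointwise_closure_hausdorff : hausdorff_space pointwise_closure.
Proof.
move=> x y xy; apply: coord_inj; apply/funext => i.
have nb z : nbhs z [set w | coord w i = coord z i].
  apply/pointwise_closure_nbhsP; exists [:: i] => w; apply.
  by rewrite inE.
by have [w [/= <- <-]] := xy _ _ (nb x) (nb y).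
Qed.

Lemma pointwise_closure_compact : compact [set: pointwise_closure].
Proof.
have cubeC : compact [set: cube].
  have := @tychonoff I (fun=> bool) (fun=> setT) (fun=> bool_compact).
  by congr (compact _); apply/seteqP; split.
have clC := subclosed_compact (@closed_closure cube E) cubeC (subsetT _).
move=> F FF _.
have [|p [Cp clp]] := clC (set_val @ F) _.
  rewrite nbhs_simpl; apply: (filterS (P := [set: pointwise_closure])) filterT => y _.
  exact/set_mem/(valP y).
have [x xp] := coord_surj ((closure_cubeP p).1 Cp).
exists x; split=> // A N FA /pointwise_closure_nbhsP[s sN].
have FA' : (set_val @ F) (set_val @` A).
  by apply: (@filterS _ F _ A _ _ FA) => y Ay; exists y.
have [|q [/= [y Ay yq] qp]] := clp _ [set q : cube | agree s q p] FA'.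
  by apply/cube_nbhsP; exists s.
by exists y; split=> //; apply: sN; rewrite xp /coord yq.
Qed.

Section TransfiniteSequences.
Context {d : Order.disp_t} {kappa : ordinalType d}.
Variable u : kappa -> pointwise_closure.
Hypothesis kappa0 : inhabited kappa.

Definition eventually_at (i : I) (b : bool) :=
  exists k, forall j, k <= j -> coord (u j) i = b.

Let eventually_agree p (s : seq I) : (forall i, i \in s -> eventually_at i (p i)) ->
  exists k, forall j, k <= j -> agree s (coord (u j)) p.
Proof.
elim: s => [|i s ih] sp; first by case: kappa0 => k; exists k.
have [k kP] := sp i (mem_head _ _).
have [k' k'P] : exists k, forall j, k <= j -> agree s (coord (u j)) p.
  by apply: ih => j js; apply: sp; rewrite inE js orbT.
exists (Order.max k k') => j; rewrite ge_max => /andP[kj k'j] i'.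
by rewrite inE => /orP[/eqP ->|]; [exact: kP|exact: k'P].
Qed.

Lemma transfinite_cvg_coord x : (forall i, eventually_at i (coord x i)) ->
  transfinite_cvg u x.
Proof.
move=> ux N /pointwise_closure_nbhsP[s sN].
have [k kP] := @eventually_agree (coord x) s (fun i _ => ux i).
by exists k => j /kP; exact: sN.
Qed.

(** Each finite set of coordinates of the limit function is attained along the
    sequence, so this function belongs to the closure. *)
Lemma transfinite_limit : (forall i, exists b, eventually_at i b) ->
  exists z, forall i, eventually_at i (coord z i).
Proof.
move=> /choice[p up]; have [|z zp] := @coord_surj p.
  apply: approximable_limit => s.
  have [k kP] := @eventually_agree p s (fun i _ => up i).
  by exists (coord (u k)); [exact: coord_approximable|exact: kP].
by exists z => i; rewrite zp.
Qed.

Lemma transfinite_cvg_closure (A : set pointwise_closure) z :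
  (forall k, A (u k)) -> transfinite_cvg u z -> closure A z.
Proof. by move=> uA uz N /uz[k kN]; exists (u k); split=> //; exact: kN. Qed.
End TransfiniteSequences.
End PointwiseClosure.

(** * The space *)

Lemma succ_ord_lt d (gamma : ordinalType d) (x y : gamma) :
  (Some x < Some y :> succ_ord gamma) = (x < y).
Proof. by rewrite !lt_neqAle. Qed.

Section LadderSpace.
Context {d : Order.disp_t} {V : ordinalType d}.
Context {d' : Order.disp_t} {W : ordinalType d'}.
Hypothesis Vbounded : forall s : nat -> V, exists b, forall k, s k < b.
Hypothesis Vcountable : forall a : V, countable [set b | b < a].
Variable U : V -> W -> V -> bool.
Hypothesis Uladder : forall a, ladder a (U a).

Local Notation I := (V * option W)%type.

(** The coordinate [(b, None)] is the set of ordinals up to [b], and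
    [(b, Some j)] is the set [U b j]. *)
Definition trace (x : V) : I -> bool :=
  fun i => if i.2 is Some j then U i.1 j x else x <= i.1.

Local Notation X := (pointwise_closure (range trace)).
Local Notation approx := (approximable (range trace)).
Implicit Types (p : I -> bool) (a b e : V).

(** The least [a] such that [p] lies in the clopen set of levels up to [a]. *)
Definition level p a := p (a, None) /\ forall b, p (b, None) -> a <= b.

Lemma level_None p a b : approx p -> level p a -> p (b, None) = (a <= b).
Proof.
move=> ap [pa amin]; apply/idP/idP => [/amin //|ab].
have [_ [x _ <-] xp] := ap [:: (a, None); (b, None)].
rewrite -xp ?inE ?eqxx ?orbT//=; apply: le_trans ab.
by have := xp (a, None); rewrite inE eqxx => /(_ isT); rewrite pa.
Qed.

Lemma None_false_Some p b j : approx p -> p (b, None) = false -> p (b, Some j) = false.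
Proof.
move=> ap pb; have [_ [x _ <-] xp] := ap [:: (b, None); (b, Some j)].
rewrite -xp ?inE ?eqxx ?orbT//=; apply/negbTE/negP => Ux.
have := xp (b, None); rewrite inE eqxx => /(_ isT); rewrite pb /= => /negbT.
by rewrite -ltNge => bx; have [/(_ _ _ Ux) xb _ _ _ _] := Uladder b;
  rewrite ltNge (ltW xb) in bx.
Qed.

Lemma level_below p a b j : approx p -> level p a -> b < a -> p (b, Some j) = false.
Proof.
by move=> ap pa ba; apply: None_false_Some; rewrite ?(level_None _ ap pa)// leNgt ba.
Qed.

(** A point of level [a] is approximated by traces of ordinals just below [a], or
    of [a] itself. *)
Lemma level_trace p a e s : approx p -> level p a -> just_below e a ->
  exists x, [/\ agree s (trace x) p, x <= a & e < x \/ x = a].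
Proof.
move=> ap pa ea; have [_ [x _ <-] xp] := ap [:: (a, None), (e, None) & s].
have xa : x <= a.
  have := xp (a, None); rewrite inE eqxx => /(_ isT).
  by rewrite (level_None _ ap pa) lexx.
exists x; split=> //.
  by move=> i si; apply: xp; rewrite !inE si !orbT.
case: ea => [ea|amin]; last by right; apply: le_anti; rewrite xa amin.
left; have := xp (e, None); rewrite !inE eqxx orbT => /(_ isT) /=.
by rewrite (level_None _ ap pa) [a <= e]leNgt ea /= => /negbT; rewrite -ltNge.
Qed.

(** The coordinates of index [b > a] depend on the level only, because [U b j] is
    constant just below [a].  So a point of level [a] is determined by its
    coordinates of index [a] ([level_coord_eq]). *)
Lemma level_above p a b j : approx p -> level p a -> a < b ->
  p (b, Some j) = U b j a.
Proof.
move=> ap pa ab; have [_ /(_ j a ab)[e ea eU] _ _ _] := Uladder b.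
have [x [xp xa ex]] := level_trace [:: (b, Some j)] ap pa ea.
rewrite -xp ?inE//=; case: ex => [ex|-> //]; exact: eU.
Qed.

Lemma level_nested a i j : i < j -> exists v : bool,
  forall p, approx p -> level p a -> p (a, Some j) -> p (a, Some i) = v.
Proof.
move=> ij; have [Ua _ /(_ i j ij)[v [e [ea ev]]] _ _] := Uladder a.
exists v => p ap pa pj.
have [x [xp xa ex]] := level_trace [:: (a, Some i); (a, Some j)] ap pa ea.
have Uj : U a j x.
  by have := xp (a, Some j); rewrite !inE eqxx orbT => /(_ isT); rewrite pj.
rewrite -xp ?inE ?eqxx//=; apply: ev => //.
by case: ex => // xE; have := Ua j x Uj; rewrite xE ltxx.
Qed.

Lemma no_level p : (forall a, ~ level p a) -> forall b, p (b, None) = false.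
Proof.
move=> nl b; apply/negP => pb.
have [|m [pm mmin]] := @ordinal_min _ V (fun b => p (b, None)); first by exists b.
by apply: (nl m).
Qed.

Variables (v0 : V) (w0 : W).

Lemma trace_near_top s : exists b, agree s (trace b) (fun=> false).
Proof.
have [b bP] := Vbounded (fun k => (nth (v0, None) s k).1); exists b.
move=> i si; have ib : i.1 < b by have := bP (index i s); rewrite nth_index.
rewrite /trace; case: i ib {si} => [a [j|]] /= ab; last by rewrite leNgt ab.
apply/negbTE/negP => Ub; have [/(_ _ _ Ub) + _ _ _ _] := Uladder a.
by rewrite ltNge (ltW ab).
Qed.

Lemma top_approx : approx (fun=> false).
Proof. by move=> s; have [b bs] := trace_near_top s; exists (trace b). Qed.

Lemma no_level_top p : approx p -> (forall a, ~ level p a) -> p = fun=> false.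
Proof.
move=> ap /no_level pN; apply/funext => -[b [j|]] //.
by apply: None_false_Some.
Qed.

Definition top : X := projT1 (cid (coord_surj top_approx)).

Lemma coord_top : coord top = fun=> false.
Proof. by rewrite /top; case: cid. Qed.

Lemma top_eq (x : X) : (forall a, ~ level (coord x) a) -> x = top.
Proof.
move=> nx; apply: coord_inj; rewrite coord_top.
exact: no_level_top (coord_approximable x) nx.
Qed.

Lemma level_coord_eq (x y : X) a : level (coord x) a -> level (coord y) a ->
  (forall j, coord x (a, Some j) = coord y (a, Some j)) -> x = y.
Proof.
move=> xa ya xy; apply: coord_inj; apply/funext => -[b o].
have ax := coord_approximable x; have ay := coord_approximable y.
case: o => [j|]; last by rewrite (level_None _ ax xa) (level_None _ ay ya).
have [ba|ab|->//] := ltgtP b a.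
  by rewrite (level_below _ ax xa)// (level_below _ ay ya).
by rewrite (level_above _ ax xa)// (level_above _ ay ya).
Qed.

(** Each choice of points whose levels are unbounded converges to [top]. *)
Lemma radial_top (A : set X) : closure A top -> exists2 u : V -> X,
  (forall a, A (u a)) & transfinite_cvg u top.
Proof.
move=> /pointwise_closure_closureP clA.
have /choice[u uP] : forall a, exists y, A y /\ coord y (a, None) = false.
  move=> a; have [y Ay yt] := clA [:: (a, None)]; exists y; split=> //.
  by rewrite yt ?inE// coord_top.
exists u => [a|]; first exact: (uP a).1.
apply: (transfinite_cvg_coord (inhabits v0)).
move=> [b o]; exists b => a ba; rewrite coord_top.
have au := coord_approximable (u a).
suff uN : coord (u a) (b, None) = false.
  by case: o => [j|//]; exact: None_false_Some.
have [[c uc]|nl] := pselect (exists c, level (coord (u a)) c); last first.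
  by apply: no_level => c uc; apply: nl; exists c.
have := (uP a).2; rewrite !(level_None _ au uc) => /negbT; rewrite -ltNge => ac.
by rewrite leNgt (le_lt_trans ba ac).
Qed.

(** Near [x], the set [A] contains points whose levels climb to [a]; the unsplit
    subsequence given by the ladder makes their coordinates of index [a] converge,
    since below [a] these coordinates only depend on the levels.  The limit has
    level [a] and agrees with [x] on [s]. *)
Lemma radial_below (A : set X) (x : X) a (s : seq I) :
  closure A x -> level (coord x) a ->
  (forall y, A y -> level (coord y) a -> ~ agree s (coord y) (coord x)) ->
  exists z, ~ A z /\ exists2 u : nat -> X, (forall k, A (u k)) & transfinite_cvg u z.
Proof.
move=> /pointwise_closure_closureP clA xa nA.
have ax := coord_approximable x.
have Apick r : exists y l, [/\ A y, agree (r ++ s) (coord y) (coord x),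
    level (coord y) l & l < a].
  have [y Ay yx] := clA ((a, None) :: r ++ s).
  have ya : coord y (a, None) by rewrite yx ?inE ?eqxx// (level_None _ ax xa).
  have ay := coord_approximable y.
  have yrs : agree (r ++ s) (coord y) (coord x).
    by move=> i ri; apply: yx; rewrite inE ri orbT.
  have [l yl] : exists l, level (coord y) l.
    apply: contrapT => nl; have := no_level (fun l yl => nl (ex_intro _ l yl)) a.
    by rewrite ya.
  exists y, l; split=> //; rewrite lt_neqAle; apply/andP; split.
    apply/eqP => la; apply: (nA y) => //; first by rewrite -la.
    by move=> i si; apply: yrs; rewrite mem_cat si orbT.
  by rewrite -(level_None _ ay yl).
pose P l := exists y, [/\ A y, agree s (coord y) (coord x) & level (coord y) l].
have [t ta /choice[y yP]] : exists2 t, climbs t a & forall k, P (t k).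
  apply: climbs_within => //.
    have [y [l [Ay yx yl la]]] := Apick [::]; exists l => //.
    by exists y.
  move=> e ea; have [y [l [Ay yx yl la]]] := Apick [:: (e, None)].
  exists l; split=> //; last first.
    by exists y; split=> // i si; apply: yx; rewrite inE si orbT.
  have ay := coord_approximable y.
  rewrite ltNge -(level_None _ ay yl) yx ?inE ?eqxx// (level_None _ ax xa).
  by rewrite -ltNge.
have [_ _ _ /(_ t ta)[phi [phiS phiU]] _] := Uladder a.
pose u k := y (phi k).
have ua k : approx (coord (u k)) by exact: coord_approximable.
have uA k : A (u k) by have [] := yP (phi k).
have ux k : agree s (coord (u k)) (coord x) by have [] := yP (phi k).
have ul k : level (coord (u k)) (t (phi k)) by have [] := yP (phi k).
have tphi := climbs_sub ta phiS; have [_ tl _] := tphi.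
have near_eventually i (v : bool) : (\forall k \near \oo, coord (u k) i = v) ->
    eventually_at u i v.
  by move=> [N _ NP]; exists N => k Nk; apply: NP.
have uNone e : e < a -> eventually_at u (e, None) false.
  move=> ea; apply: near_eventually; apply: filterS (climbs_near tphi ea) => k ek.
  by rewrite (level_None _ (ua k) (ul k)) leNgt ek.
have uaNone : eventually_at u (a, None) true.
  by exists 0%N => k _; rewrite (level_None _ (ua k) (ul k)) ltW// tl.
have [[b o]|z uz] := transfinite_limit (inhabits 0%N) (u := u).
  case: o => [j|]; last first.
    have [ba|ab] := ltP b a; first by exists false; exact: uNone.
    exists true, 0%N => k _; rewrite (level_None _ (ua k) (ul k)).
    exact: le_trans (ltW (tl k)) ab.
  have [ba|ab|->] := ltgtP b a.
  - exists false; apply: near_eventually.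
    apply: filterS (climbs_near tphi ba) => k bk.
    by rewrite (level_below _ (ua k) (ul k)).
  - exists (U b j a); apply: near_eventually.
    have [_ /(_ j a ab)[e ea eU] _ _ _] := Uladder b.
    have e_a := just_below_lt ea (tl 0%N).
    apply: filterS (climbs_near tphi e_a) => k ek.
    rewrite (level_above _ (ua k) (ul k)) ?(lt_trans (tl k))//.
    by apply: eU => //; exact/ltW/tl.
  - have [v] := phiU j; exists v; apply: near_eventually.
    by apply: filterS p => k <-; rewrite (level_above _ (ua k) (ul k)) ?tl.
exists z; split; last first.
  by exists u; [exact: uA|exact: (transfinite_cvg_coord (inhabits 0%N) uz)].
have coordz i (v : bool) : eventually_at u i v -> coord z i = v.
  move=> [k kP]; have [k' k'P] := uz i.
  by rewrite -(kP (Order.max k k')) ?k'P// le_max lexx ?orbT.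
have za : level (coord z) a.
  split; first exact: coordz uaNone.
  move=> b zb; rewrite leNgt; apply/negP => ba.
  by have := coordz _ _ (uNone b ba); rewrite zb.
move=> Az; apply: (nA z Az za) => i si; apply: coordz.
by exists 0%N => k _; exact: ux.
Qed.

(** [P j] says that points of [A] of level [a] agree with [x] up to [j] arbitrarily
    close to [x]; it defines an initial segment.  Pick [u j] in [A] that agrees with
    [x] up to [j], for [j] in [P], all inside a neighbourhood [s] of [x] that
    witnesses the failure of [P] at its first failure.  Coordinates in [P]
    converge to those of [x].  A coordinate [j] outside [P] vanishes eventually: if
    it is true at one point [u k1], this point differs from [x] at some [i] in [P],
    and since [U a j] is almost inside or almost outside [U a i], points that agree
    with [x] at [i] are outside [U a j].  The limit agrees with [x] on [P] and on
    [s], hence is outside [A] by the choice of [s]. *)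
Lemma radial_within (A : set X) (x : X) a :
  ~ A x -> level (coord x) a ->
  (forall s, exists y, [/\ A y, level (coord y) a & agree s (coord y) (coord x)]) ->
  exists (P : pred W) (z : X), ~ A z /\
    exists2 u : subordinal P -> X, (forall k, A (u k)) & transfinite_cvg u z.
Proof.
move=> nAx xa xA; have ax := coord_approximable x.
pose same (y : X) j := coord y (a, Some j) = coord x (a, Some j).
pose good s j := exists y : X, [/\ A y, level (coord y) a, agree s (coord y) (coord x)
  & forall i, i <= j -> same y i].
pose P : pred W := fun j => `[< forall s, good s j >].
have Pdown i j : i <= j -> P j -> P i.
  move=> ij /asboolP Pj; apply/asboolP => s; have [y [Ay ya yx yj]] := Pj s.
  by exists y; split=> // k /le_trans ki; apply: yj; exact: ki.
have [s sP] : exists s, forall y, A y -> level (coord y) a ->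
    agree s (coord y) (coord x) -> (forall j, P j) \/ exists2 j, P j & ~ same y j.
  have [|nP] := pselect (forall j, P j); first by move=> allP; exists [::]; left.
  have [|j [nPj jmin]] := @ordinal_min _ W (fun j => ~ P j).
    by apply: contrapT => n; apply: nP => j; apply: contrapT => nj; apply: n; exists j.
  have [s ns] : exists s, ~ good s j.
    by apply: contrapT => n; apply: nPj; apply/asboolP => s; apply: contrapT => ns;
      apply: n; exists s.
  (* Fixing the coordinate [j] as well forces a disagreement strictly before the
     first failure [j], that is, inside [P]. *)
  exists ((a, Some j) :: s) => y Ay ya yx; right; apply: contrapT => nd.
  apply: ns; exists y; split=> //.
    by move=> i si; apply: yx; rewrite inE si orbT.
  move=> i; rewrite le_eqVlt => /orP[/eqP ->|ij].
    by apply: yx; exact: mem_head.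
  apply: contrapT => ni; apply: nd; exists i => //.
  by apply: contrapT => /jmin; rewrite leNgt ij.
have [k0 Pk0] : exists k, P k.
  have [y [Ay ya yx]] := xA s.
  by have [|[k]] := sP y Ay ya yx; [exists w0|exists k].
have /choice[u uP] : forall k : subordinal P, exists y, [/\ A y, level (coord y) a,
    agree s (coord y) (coord x) & forall i, i <= val k -> same y i].
  by move=> k; have /asboolP/(_ s) := valP k.
have ua k : approx (coord (u k)) by exact: coord_approximable.
have uA k : A (u k) by have [] := uP k.
have ul k : level (coord (u k)) a by have [] := uP k.
have us k : agree s (coord (u k)) (coord x) by have [] := uP k.
have usame k i : i <= val k -> same (u k) i by have [_ _ _] := uP k; exact.
pose kk0 : subordinal P := Sub k0 Pk0.
have uPj j : P j -> eventually_at u (a, Some j) (coord x (a, Some j)).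
  by move=> Pj; exists (Sub j Pj : subordinal P) => k; rewrite leEsub SubK => /usame.
have uconst i : i.1 != a \/ i.2 = None -> eventually_at u i (coord x i).
  move=> ia; exists kk0 => k _; case: i ia => [b [j|]] /= [ba|] //.
  - have [ba'|ab|E] := ltgtP b a; last by rewrite E eqxx in ba.
      by rewrite !(level_below _ _ _ ba').
    by rewrite !(level_above _ _ _ ab).
  - by rewrite !(level_None _ _ (_ : level _ a)).
  - by rewrite !(level_None _ _ (_ : level _ a)).
have [[b o]|z uz] := transfinite_limit (inhabits kk0) (u := u).
  have [ba|ba] := eqVneq b a; last by exists (coord x (b, o)); apply: uconst; left.
  case: o => [j|]; last by exists (coord x (b, None)); apply: uconst; right.
  rewrite {}ba; have [Pj|nPj] := boolP (P j).
    by exists (coord x (a, Some j)); exact: uPj.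
  exists false; have [[k1 uk1]|nk] := pselect (exists k, coord (u k) (a, Some j)); last first.
    by exists kk0 => k _; apply/negP => uk; apply: nk; exists k.
  have [allP|[i Pi ui]] := sP _ (uA k1) (ul k1) (us k1).
    by rewrite allP in nPj.
  have ij : i < j by rewrite ltNge; apply/negP => ji; rewrite (Pdown _ _ ji Pi) in nPj.
  have [v vP] := level_nested a ij.
  have [k kP] := uPj i Pi; exists k => k' kk'; apply/negP => uk'.
  by apply: ui; rewrite /same (vP _ (ua k1) (ul k1) uk1) -(kP k' kk') (vP _ (ua _) (ul _) uk').
exists P, z; split; last first.
  by exists u; [exact: uA|exact: (transfinite_cvg_coord (inhabits kk0) uz)].
have coordz i (v : bool) : eventually_at u i v -> coord z i = v.
  move=> [k kP]; have [k' k'P] := uz i.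
  by rewrite -(kP (Order.max k k')) ?k'P// le_max lexx ?orbT.
have za : level (coord z) a.
  split; first by rewrite (coordz _ _ (uconst (a, None) _)); [exact: xa.1|right].
  move=> b; rewrite (coordz _ _ (uconst (b, None) _)); last by right.
  exact: xa.2.
move=> Az; have zs : agree s (coord z) (coord x).
  by move=> i si; apply: coordz; exists kk0 => k _; exact: us.
have [allP|[j Pj]] := sP z Az za zs; last by apply; exact: coordz (uPj j Pj).
apply: nAx; rewrite -(level_coord_eq za xa)// => j.
exact: coordz (uPj j (allP j)).
Qed.

Lemma ladder_space_pseudoradial : pseudoradial X.
Proof.
move=> A nclA; have [x clAx nAx] : exists2 x, closure A x & ~ A x.
  apply: contrapT => nx; apply: nclA => x clx; apply: contrapT => nAx.
  by apply: nx; exists x.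
have conclude d0 (kappa : ordinalType d0) (k0 : kappa) (u : kappa -> X) z : ~ A z ->
    (forall k, A (u k)) -> transfinite_cvg u z ->
    exists2 x, (closure A `\` A) x &
    exists d (kappa : ordinalType d) (u : kappa -> X),
      (forall k, A (u k)) /\ transfinite_cvg u x.
  move=> nAz uA uz; exists z; last by exists d0, kappa, u.
  by split=> //; exact: transfinite_cvg_closure uA uz.
have [[a xa]|nx] := pselect (exists a, level (coord x) a); last first.
  have xtop : x = top by apply: top_eq => a xa; apply: nx; exists a.
  rewrite xtop in clAx nAx; have [u uA utop] := radial_top clAx.
  exact: conclude v0 u top nAx uA utop.
have [xA|] := pselect (forall s, exists y,
    [/\ A y, level (coord y) a & agree s (coord y) (coord x)]).
  have [P [z [nAz [u uA uz]]]] := radial_within nAx xa xA.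
  have [k _] := uz setT (@filterT _ (nbhs z) _).
  exact: conclude k u z nAz uA uz.
move=> /existsNP[s sP]; have [|z [nAz [u uA uz]]] := @radial_below A x a s clAx xa.
  by move=> y Ay ya yx; apply: sP; exists y.
exact: conclude 0%N u z nAz uA uz.
Qed.

Section ContinuousOrdinal.
Context {dg : Order.disp_t} {gamma : ordinalType dg}.
Hypothesis gamma_limit : limit_ordinal gamma.
Variable f : order_topology (succ_ord gamma) -> X.
Hypothesis fcont : continuous f.
Hypothesis ftop : f None = top.
Hypothesis fnottop : forall x : gamma, f (Some x) <> top.

Let F x := coord (f (Some x)).
Let Fa x : approx (F x). Proof. exact: coord_approximable. Qed.

Let Fleft x i y : y < x ->
  exists2 e, e < x & forall z, e < z -> z <= x -> F z i = F x i.
Proof.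
move=> yx.
have : nbhs (f (Some x)) [set w | coord w i = coord (f (Some x)) i].
  by apply/pointwise_closure_nbhsP; exists [:: i] => w; apply; rewrite inE.
move=> /fcont /=; rewrite itv_nbhsE => -[[l r] [lr xlr] lrN].
move: xlr; rewrite itv_boundlr => /andP[lx xr].
have xr' z : z <= x -> (BRight (Some z : succ_ord gamma) <= r)%O.
  by move=> zx; apply: le_trans xr; rewrite bnd_simp.
case: l lr lx lrN => [[] [l|]|[]] //= _ lx lrN.
- exists l; first by move: lx; rewrite bnd_simp succ_ord_lt.
  move=> z lz zx; apply: (lrN (Some z)); rewrite /= itv_boundlr xr'// andbT.
  by rewrite bnd_simp succ_ord_lt.
- exists y => // z yz zx; apply: (lrN (Some z)); rewrite /= itv_boundlr xr'// andbT.
Qed.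

Let Ftop b : exists e : gamma, forall x : gamma, e < x -> F x (b, None) = false.
Proof.
have : nbhs (f None) [set w | coord w (b, None) = coord (f None) (b, None)].
  by apply/pointwise_closure_nbhsP; exists [:: (b, None)] => w; apply; rewrite inE.
move=> /fcont /=; rewrite itv_nbhsE => -[[l r] [lr xlr] lrN].
move: xlr; rewrite itv_boundlr => /andP[lx xr].
have xr' (z : gamma) : (BRight (Some z : succ_ord gamma) <= r)%O.
  by apply: le_trans xr; rewrite bnd_simp.
have Fl z : (l <= BLeft (Some z : succ_ord gamma))%O -> F z (b, None) = false.
  move=> lz; have := lrN (Some z); rewrite /= itv_boundlr lz xr' => /(_ isT).
  by rewrite /F ftop coord_top.
have [[g0] _] := gamma_limit.
case: l lr lx lrN Fl => [[] [l|]|[]] //= _ lx lrN Fl.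
- by exists l => x lx'; apply: Fl; rewrite bnd_simp succ_ord_lt.
- by exists g0 => x _; apply: Fl.
Qed.

Let lev_ex x : exists a, level (F x) a.
Proof.
apply: contrapT => nl; apply: (fnottop (x := x)); apply: top_eq => a xa.
by apply: nl; exists a.
Qed.

Let lev x := projT1 (cid (lev_ex x)).
Let levP x : level (F x) (lev x). Proof. exact: projT2 (cid (lev_ex x)). Qed.

Let FN x b : F x (b, None) = (lev x <= b).
Proof. exact: level_None (Fa x) (levP x). Qed.

(** The levels are bounded in [omega_1], so the sequence cannot be cofinal in
    [gamma], by continuity at the last point; hence it has a limit in [gamma], and
    continuity there makes the levels climb to the level of the limit. *)
Let climbs_lev s : (forall k, s k < s k.+1) -> (forall k, lev (s k) < lev (s k.+1)) ->
  exists x, climbs s x /\ climbs (lev \o s) (lev x).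
Proof.
move=> sS levS; have [b bP] := Vbounded (lev \o s).
have [e eP] := Ftop b.
have [|x sx] := increasing_climbs sS.
  exists e => k; rewrite leNgt; apply/negP => /eP.
  by rewrite FN leNgt => /negbFE; rewrite ltNge (ltW (bP k)).
exists x; split=> //; have [_ sl _] := sx.
have Fnear i : \forall k \near \oo, F (s k) i = F x i.
  have [e' e'x e'F] := Fleft i (sl 0%N).
  by apply: filterS (climbs_near sx e'x) => k /e'F; apply; exact/ltW/sl.
split=> //= [k|c cx].
  have [N _ NP] := Fnear (lev (s k), None).
  have := NP (maxn N k.+1) (leq_maxl _ _); rewrite !FN.
  rewrite leNgt (@increasing_lt _ _ (lev \o s))// ?leq_maxr//.
  by move=> /esym/negbT; rewrite -ltNge.
have [N _ NP] := Fnear (c, None); exists N.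
have := NP N (leqnn N); rewrite !FN [X in _ = X]leNgt cx => /negbT.
by rewrite -ltNge.
Qed.

(** Iterating [lim] from a point of [gamma] yields an [omega^2]-sequence whose
    levels form a double climb to [lev D].  Some set of the ladder at [lev D] splits
    it, against continuity at [D]. *)
Lemma continuous_ordinal_absurd : False.
Proof.
have [[g0] glim] := gamma_limit.
have /choice[next nextP] : forall x, exists y, x < y /\ lev x < lev y.
  move=> x; have [e eP] := Ftop (lev x).
  have [y] := glim (Order.max e x); rewrite gt_max => /andP[ey xy].
  by exists y; split=> //; have := eP y ey; rewrite FN => /negbT; rewrite -ltNge.
pose s x k := iter k.+1 next x.
have /choice[lim limP] : forall x, exists y, climbs (s x) y /\ climbs (lev \o s x) (lev y).
  by move=> x; apply: climbs_lev => k; have [] := nextP (s x k).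
pose q n := iter n.+1 lim g0.
have qs n k : q n < s (q n) k /\ s (q n) k < q n.+1.
  have [[sS sl _] _] := limP (q n); split; last exact: sl.
  exact: lt_le_trans (nextP (q n)).1 (increasing_le sS (leq0n k)).
have levq n : lev (q n) < lev (s (q n) 0%N) by exact: (nextP (q n)).2.
have qS n : q n < q n.+1 by have [] := qs n 0%N; exact: lt_trans.
have [|D [qD levD]] := climbs_lev qS.
  move=> n; have [_ [_ /(_ 0%N) + _]] := limP (q n); exact: lt_trans.
pose c n k := lev (s (q n) k); pose l n := lev (q n.+1).
have [_ qltD _] := qD; have [_ levltD _] := levD.
have cl : double_climb (lev D) c l.
  split=> [n|n|]; first by have [] := limP (q n).
    exact: levq.
  by apply: climbs_sub levD _ => k.
have [_ _ _ _ /(_ c l cl)[i]] := Uladder (lev D).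
apply; have [e eD eF] := Fleft (lev D, Some i) (qltD 0%N).
exists (F D (lev D, Some i)); apply: filterS (climbs_near qD eD) => n en.
have FU x : e < x -> x < D -> lev x < lev D -> U (lev D) i (lev x) = F D (lev D, Some i).
  move=> ex xD lxD; rewrite -(eF x ex (ltW xD)).
  by rewrite (level_above _ (Fa x) (levP x)).
split=> [|k].
  exact: FU (lt_trans en (qS n)) (qltD n.+1) (levltD n.+1).
have [qs1 qs2] := qs n k; apply: FU.
- exact: lt_trans en qs1.
- exact: lt_trans qs2 (qltD _).
- have [_ [_ /(_ k) sl _]] := limP (q n); exact: lt_trans sl (levltD n.+1).
Qed.
End ContinuousOrdinal.

Lemma ladder_space_not_strongly_pseudoradial : ~ strongly_pseudoradial X.
Proof.
move=> strong; have [ncl|] := pselect (~ closed (~` [set top])); last first.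
  move=> /contrapT clA; have : closure (~` [set top]) top; last by move=> /clA; apply.
  apply/pointwise_closure_closureP => s; have [b bs] := trace_near_top s.
  have tb : approx (trace b) by move=> r; exists (trace b).
  have [y yE] := coord_surj tb; exists y; last by rewrite yE coord_top.
  move=> ytop; have := congr1 (fun x => coord x (b, None)) ytop.
  by rewrite yE coord_top /trace /= lexx.
have [dg [gamma [f [glim fcont fA fN]]]] := strong _ ncl.
by apply: (continuous_ordinal_absurd glim fcont) => //; exact: contrapT.
Qed.
End LadderSpace.

Theorem theorem1p4 (d : Order.disp_t) (omega2 : ordinalType d)
    (homega2 : is_omega 2 omega2)
    (hb : is_bounding_number omega2)
    (hc : is_continuum omega2) :
  exists X : topologicalType,
    [/\ compact [set: X]%classic, hausdorff_space X,
        pseudoradial X & ~ strongly_pseudoradial X].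
Proof.
have [d' [V [V1 nVW Wsmall]]] := homega2.
have Vbounded := omega1_sequence_bounded _ V1.
have Vcountable a := omega1_initial_countable a V1.
have small (j : omega2) : dominable (fun i => i < j).
  exact: bounding_dominable hb nVW (Wsmall j).
have /choice[U Uladder] : forall a : V, exists U : omega2 -> V -> bool, ladder a U.
  move=> a; have [e eP] := continuum_enumerates hc (Vcountable a).
  exact: (ladder_exists small eP).
have [v0] : inhabited V.
  apply: contrapT => nV; apply: (omega1_uncountable V1).
  suff -> : [set: V] = set0 by [].
  by apply/seteqP; split=> // x _; apply: nV.
have [w0] : inhabited omega2.
  apply: contrapT => nW; apply: nVW.
  suff -> : [set: omega2] = set0 by exact: card_ge0.
  by apply/seteqP; split=> // x _; apply: nW.
exists (pointwise_closure (range (trace U))); split.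
- exact: pointwise_closure_compact.
- exact: pointwise_closure_hausdorff.
- exact: ladder_space_pseudoradial.
- exact: ladder_space_not_strongly_pseudoradial.
Qed.
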